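(* Let $G$ be a (possibly non-associative) algebra over an arbitrary field, let $N$ be a subspace of $G$ of finite codimension, and let $w$ be a multilinear element of a free (non-associative) algebra. If $w(N,\ldots,N)$ is contained in some finite-dimensional subspace of $G$, then $G$ contains a subspace $H$ of finite codimension, invariant under all automorphisms of the algebra $G$, such that $w(H,\ldots,H)$ is also contained in a finite-dimensional subspace of $G$.
   Context: A multilinear element $w(x_1,\ldots,x_n)$ of degree $n$ of a free (non-associative) algebra is a linear combination of non-associative monomials each of which contains each of $x_1,\ldots,x_n$ exactly once. For a subspace $H\subseteq G$, $w(H,\ldots,H)=\{w(h_1,\ldots,h_n): h_i\in H\}$. *)

(* Defs.v *)
From HB Require Import structures.
From mathcomp Require Import all_boot all_order all_algebra.
From mathcomp Require Import finmap classical_sets.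
From mathcomp.multinomials Require Import monalg.

Set Implicit Arguments.
Unset Strict Implicit.
Unset Printing Implicit Defensive.

Import GRing.Theory.

Local Open Scope classical_set_scope.
Local Open Scope ring_scope.

(* Non-associative monomials; there is no empty monomial, since algebras are
   not assumed unital. *)
Inductive namonom (X : Type) : Type :=
| NaVar of X
| NaMul of namonom X & namonom X.
Arguments NaVar {X} _.

Fixpoint navars {X : Type} (m : namonom X) : seq X :=
  match m with
  | NaVar x => [:: x]
  | NaMul m1 m2 => navars m1 ++ navars m2
  end.

Section NamonomChoice.
Variable X : choiceType.

Fixpoint namonom_tree (m : namonom X) : GenTree.tree X :=
  match m with
  | NaVar x => GenTree.Leaf x
  | NaMul m1 m2 => GenTree.Node 0 [:: namonom_tree m1; namonom_tree m2]
  end.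

Fixpoint tree_namonom (t : GenTree.tree X) : option (namonom X) :=
  match t with
  | GenTree.Leaf x => Some (NaVar x)
  | GenTree.Node _ [:: t1; t2] =>
      if (tree_namonom t1, tree_namonom t2) is (Some m1, Some m2)
      then Some (NaMul m1 m2) else None
  | _ => None
  end.

Lemma namonom_treeK : pcancel namonom_tree tree_namonom.
Proof. by elim=> //= m1 -> m2 ->. Qed.

HB.instance Definition _ := Choice.copy (namonom X) (pcan_type namonom_treeK).

End NamonomChoice.

(* The free non-associative K-algebra on x_0, ..., x_{n-1}: the vector space
   with basis the monomials, whose product extends [NaMul] bilinearly. *)
Notation freeNA K n := {malg K[namonom 'I_n]}.

Definition freeNA_mul (K : fieldType) (n : nat) (p q : freeNA K n) :
    freeNA K n :=
  \sum_(a <- msupp p) \sum_(b <- msupp q) << p@_a * q@_b *g NaMul a b >>.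

Definition multilinear (K : fieldType) (n : nat) (w : freeNA K n) : Prop :=
  forall m, m \in msupp w -> forall i : 'I_n, count_mem i (navars m) = 1%N.

Section Evaluation.
Variables (K : fieldType) (G : lmodType K) (mul : {bilinear G -> G -> G}).
Variables (n : nat) (h : 'I_n -> G).

Fixpoint namonom_eval (m : namonom 'I_n) : G :=
  match m with
  | NaVar i => h i
  | NaMul m1 m2 => mul (namonom_eval m1) (namonom_eval m2)
  end.

(* w(h_0, ..., h_{n-1}) *)
Definition freeNA_eval (w : freeNA K n) : G :=
  \sum_(m <- msupp w) w@_m *: namonom_eval m.

Lemma freeNA_evalEw (D : {fset namonom 'I_n}) (w : freeNA K n) :
  (msupp w `<=` D)%fset ->
  freeNA_eval w = \sum_(m <- D) w@_m *: namonom_eval m.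
Proof.
move=> wD; rewrite /freeNA_eval (big_fset_incl _ wD) // => m _ mw.
by rewrite mcoeff_outdom // scale0r.
Qed.

Lemma freeNA_eval_linear : linear freeNA_eval.
Proof.
move=> c u v; set D := (msupp u `|` msupp v)%fset.
have uD : (msupp u `<=` D)%fset by apply: fsubsetUl.
have vD : (msupp v `<=` D)%fset by apply: fsubsetUr.
have uvD : (msupp (c *: u + v) `<=` D)%fset.
  by apply: (fsubset_trans (msuppD_le _ _)); apply: fsetSU; apply: msuppZ_le.
rewrite (freeNA_evalEw uD) (freeNA_evalEw vD) (freeNA_evalEw uvD).
rewrite scaler_sumr -big_split /=; apply: eq_bigr => m _.
by rewrite mcoeffD mcoeffZ scalerDl scalerA.
Qed.

HB.instance Definition _ :=
  GRing.isLinear.Build K (freeNA K n) G _ freeNA_eval freeNA_eval_linear.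

Lemma freeNA_evalU (c : K) (m : namonom 'I_n) :
  freeNA_eval << c *g m >> = c *: namonom_eval m.
Proof.
by rewrite (freeNA_evalEw (msuppU_le)) big_seq_fset1 mcoeffUU.
Qed.

(* Together with linearity: evaluation at h is the algebra homomorphism
   sending each x_i to h i. *)
Lemma freeNA_evalX (i : 'I_n) : freeNA_eval << NaVar i >> = h i.
Proof. by rewrite freeNA_evalU scale1r. Qed.

Lemma freeNA_evalM (p q : freeNA K n) :
  freeNA_eval (freeNA_mul p q) = mul (freeNA_eval p) (freeNA_eval q).
Proof.
rewrite /freeNA_mul linear_sum /= [freeNA_eval p in RHS]/freeNA_eval linear_sumlz.
apply: eq_bigr => a _; rewrite linear_sum /= linearZl_LR.
rewrite [freeNA_eval q]/freeNA_eval linear_sumr scaler_sumr.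
by apply: eq_bigr => b _; rewrite freeNA_evalU linearZr_LR scalerA.
Qed.

End Evaluation.

Section Subspaces.
Variables (K : fieldType) (G : lmodType K).

Definition subspace (A : set G) : Prop := submod_closed [in A].

Definition finite_dim (A : set G) : Prop :=
  exists (d : nat) (b : 'I_d -> G),
    A = [set \sum_i c i *: b i | c in [set: 'I_d -> K]].

(* The cosets of b_0, ..., b_{d-1} span the quotient space G / A. *)
Definition finite_codim (A : set G) : Prop :=
  exists (d : nat) (b : 'I_d -> G),
    forall v, exists c : 'I_d -> K, A (v - \sum_i c i *: b i).

Definition in_finite_dim (A : set G) : Prop :=
  exists F : set G, [/\ subspace F, finite_dim F & A `<=` F].

End Subspaces.

Section Algebras.
Variables (K : fieldType) (G : lmodType K) (mul : {bilinear G -> G -> G}).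

Definition automorphism (phi : {linear G -> G}) : Prop :=
  bijective phi /\ {morph phi : x y / mul x y}.

(* w(A, ..., A) *)
Definition values (n : nat) (w : freeNA K n) (A : set G) : set G :=
  [set freeNA_eval mul h w | h in [set h : 'I_n -> G | forall i, A (h i)]].

End Algebras.

(* Main.v *)
From HB Require Import structures.
Require Import Defs.
From mathcomp Require Import all_boot all_order all_algebra.
From mathcomp Require Import finmap boolp classical_sets.
From mathcomp.multinomials Require Import monalg.

Set Implicit Arguments.
Unset Strict Implicit.
Unset Printing Implicit Defensive.

Import GRing.Theory.

Local Open Scope classical_set_scope.
Local Open Scope ring_scope.

(** Call a set of values small if it lies in a finite-dimensional subspace.
    Only two properties of [w] matter: it is linear in each argument
    ([freeNA_eval_multilinear]) and it commutes with automorphisms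
    ([freeNA_eval_morph]).

    The arguments are made to range over an invariant subspace one position at
    a time ([replace_arguments]). Suppose that [L] is an invariant subspace and
    that both [L] and [M] have finite codimension, and that
    [w (L, ..., L, M, M, ..., M)] is small with [k] arguments in [L]. Let [S] be
    the sum of the images of [M] under all automorphisms. It contains [M], so
    it has finite codimension and is generated by [M] and finitely many vectors
    [c_j]; each [c_j] is a sum of finitely many elements [phi m] with [m] in
    [M]. Now [w (L, ..., L, phi M, phi M, ..., phi M)] is the image under [phi]
    of a small set, since [phi L = L], hence is small. So if [P] is the
    intersection of [M] with the finitely many subspaces [phi M] that occur,
    then linearity in the argument in position [k] shows that
    [w (L, ..., L, S, P, ..., P)] is small; and [P] has finite codimension.
    Replacing [L] with its intersection with [S], and [M] with [P], carries out
    one step. The process begins with [L = G] and [M = N], and after all the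
    arguments have been replaced [L] is the required subspace.

    The finitely many automorphisms are never listed. The vectors [c] for which
    a suitable [P] exists form a subspace ([tame_comb]) containing every
    [phi M] ([tame_image]), hence containing [S], the smallest such subspace;
    this applies to each [c_j]. *)

(** * Extending a subspace by finitely many vectors *)

Section Adjoin.
Variables (K : fieldType) (G : lmodType K).
Implicit Types (A B S : set G) (s t : seq G) (u v : G) (a : K).

Lemma subspaceP A :
  subspace A <-> A 0 /\ forall a u v, A u -> A v -> A (a *: u + v).
Proof.
split=> [[A0 AL] | [A0 AL]]; split; rewrite ?inE //.
- by move: A0; rewrite inE.
- by move=> a u v Au Av; have := AL a u v; rewrite !inE; apply.
- by move=> a u v; rewrite !inE; apply: AL.
Qed.

Lemma subspace0 A : subspace A -> A 0.
Proof. by case/subspaceP. Qed.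

Lemma subspaceL A a u v : subspace A -> A u -> A v -> A (a *: u + v).
Proof. by case/subspaceP=> _; apply. Qed.

Lemma subspaceBZ A a u v : subspace A -> A u -> A v -> A (v - a *: u).
Proof. by move=> sA Au Av; rewrite addrC -scaleNr; apply: subspaceL. Qed.

Lemma subspace_setT : subspace [set: G].
Proof. exact/subspaceP. Qed.

Lemma subspace_zero : subspace [set 0 : G].
Proof.
by apply/subspaceP; split=> // a u v /= -> ->; rewrite scaler0 addr0.
Qed.

Lemma subspaceI A B : subspace A -> subspace B -> subspace (A `&` B).
Proof.
move=> sA sB; apply/subspaceP; split; first by split; apply: subspace0.
by move=> a u v [Au Bu] [Av Bv]; split; apply: subspaceL.
Qed.

(** The sum of [A] and the span of [s]. Over [A = 0] it describes the
    finite-dimensional subspaces, and over a general [A] those of finite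
    dimension modulo [A], so one notion serves for dimension and for
    codimension. The recursion on [s] lets both be handled one vector at a
    time. *)
Fixpoint adjoin A s : set G :=
  if s is b :: s' then [set v | exists k : K, adjoin A s' (v - k *: b)] else A.

Lemma adjoin_cat A s t : adjoin A (s ++ t) = adjoin (adjoin A t) s.
Proof. by elim: s => //= b s ->. Qed.

Lemma adjoinS A B s : A `<=` B -> adjoin A s `<=` adjoin B s.
Proof. by move=> AB; elim: s => //= b s IHs v [k /IHs ?]; exists k. Qed.

Lemma sub_adjoin A s : A `<=` adjoin A s.
Proof.
elim: s => //= b s IHs v Av; exists 0.
by rewrite scale0r subr0; apply: IHs.
Qed.

Lemma subspace_adjoin A s : subspace A -> subspace (adjoin A s).
Proof.
move=> sA; elim: s => //= b s IHs; apply/subspaceP; split.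
  by exists 0; rewrite scale0r subr0; apply: subspace0.
move=> a u v [k Bu] [l Bv]; exists (a * k + l).
have -> : a *: u + v - (a * k + l) *: b = a *: (u - k *: b) + (v - l *: b).
  by rewrite scalerDl opprD addrACA -scalerA -scalerBr.
exact: subspaceL.
Qed.

Lemma adjoin_image (phi : {linear G -> G}) A s v :
  adjoin A s v -> adjoin (phi @` A) (map phi s) (phi v).
Proof.
elim: s v => [|b s IHs] v /=; first by move=> Av; exists v.
by case=> k /IHs; rewrite linearB linearZ => ?; exists k.
Qed.

(** A subspace of a space of finite dimension modulo [B] again has finite
    dimension modulo [B]: one new vector is adjoined at a time, and if it
    contributes to [S] at all, then its contribution is generated by any
    element of [S] having a non-zero coefficient at it. *)
Lemma adjoin_subspace S B s :
  subspace S -> subspace B -> S `<=` adjoin B s ->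
  exists2 t, {in t, forall c, S c} & S `<=` adjoin (S `&` B) t.
Proof.
move=> sS sB; elim: s S sS => /= [|b s IHs] S sS SB.
  by exists [::] => // v Sv; split=> //; apply: SB.
have sBs := subspace_adjoin s sB.
have [t tS IH] : exists2 t, {in t, forall c, (S `&` adjoin B s) c} &
    S `&` adjoin B s `<=` adjoin (S `&` B) t.
  have [||t tS IH] := IHs (S `&` adjoin B s); first exact: subspaceI.
    by move=> v [].
  by exists t => // v /IH; apply: adjoinS => u [[Su _] Bu].
have [SBs | /existsNP[c /not_implyP[Sc NBc]]] := EM (S `<=` adjoin B s).
  by exists t => [c /tS[] | v Sv] //; apply: IH; split=> //; apply: SBs.
(* [l] is the coefficient of [c] at the new vector [b]; subtracting a multiple
   of [c] from a vector of [S] removes its [b]-component. *)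
have [l Bc] := SB c Sc.
have l0 : l != 0.
  by apply/eqP=> l0; apply: NBc; move: Bc; rewrite l0 scale0r subr0.
exists (c :: t) => [d | v Sv].
  by rewrite inE => /predU1P[-> // | /tS[]].
have [k Bv] := SB v Sv; exists (k / l); apply: IH; split.
  exact: subspaceBZ.
have -> : v - (k / l) *: c = v - k *: b - (k / l) *: (c - l *: b).
  by rewrite scalerBr scalerA divfK // opprB addrA subrK.
exact: subspaceBZ.
Qed.

(** For an injective indexing of the vectors by a type with decidable equality,
    the coefficients chosen one after another assemble into one function;
    distinct indices are needed, distinct vectors are not. *)
Lemma adjoin_mapP (I : eqType) (r : seq I) (b : I -> G) A v : uniq r ->
  adjoin A (map b r) v <-> exists c : I -> K, A (v - \sum_(i <- r) c i *: b i).
Proof.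
elim: r v => [|i r IHr] v /=.
  by split=> [Av | [c]]; [exists (fun=> 0)|]; rewrite big_nil subr0.
case/andP=> ir ur; split=> [[k /(IHr _ ur)[c Ac]] | [c Ac]].
  exists (fun j => if j == i then k else c j).
  rewrite big_cons eqxx opprD addrA.
  rewrite (eq_big_seq (fun j => c j *: b j)) // => j jr.
  by case: eqP jr ir => // -> ->.
exists (c i); apply/(IHr _ ur); exists c.
by move: Ac; rewrite big_cons opprD addrA.
Qed.

Lemma finite_codimP A : finite_codim A <-> exists s, adjoin A s = [set: G].
Proof.
split=> [[d [b Ab]] | [s As]].
  exists (map b (enum 'I_d)); apply/seteqP; split=> // v _.
  by apply/adjoin_mapP; rewrite ?enum_uniq //; case: (Ab v) => c; exists c;
    rewrite big_enum.
exists (size s), (tnth (in_tuple s)) => v.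
have : adjoin A (map (tnth (in_tuple s)) (enum 'I_(size s))) v.
  by rewrite map_tnth_enum /= As.
by case/adjoin_mapP=> [|c]; rewrite ?enum_uniq // big_enum; exists c.
Qed.

Lemma in_finite_dimP A :
  in_finite_dim A <-> exists s, A `<=` adjoin [set 0] s.
Proof.
split=> [[F [_ [d [b ->]] AF]] | [s As]].
  exists (map b (enum 'I_d)) => v /AF[c _ <-].
  apply/adjoin_mapP; rewrite ?enum_uniq //; exists c.
  by rewrite big_enum /= subrr.
exists (adjoin [set 0] s); split=> //.
  exact/subspace_adjoin/subspace_zero.
exists (size s), (tnth (in_tuple s)).
rewrite -[s in LHS](map_tnth_enum (in_tuple s)).
apply/seteqP; split=> v.
  case/adjoin_mapP=> [|c /eqP]; rewrite ?enum_uniq // big_enum /= subr_eq0.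
  by move/eqP->; exists c.
case=> c _ <-; apply/adjoin_mapP; rewrite ?enum_uniq //.
by exists c; rewrite big_enum /= subrr.
Qed.

Lemma finite_codim_sub A B : A `<=` B -> finite_codim A -> finite_codim B.
Proof.
move=> AB /finite_codimP[s As]; apply/finite_codimP; exists s.
by apply/seteqP; split=> // v _; apply: (adjoinS AB); rewrite As.
Qed.

Lemma finite_codim_setT : finite_codim [set: G].
Proof. by apply/finite_codimP; exists [::]. Qed.

Lemma finite_codim_image (phi : {linear G -> G}) A :
  bijective phi -> finite_codim A -> finite_codim (phi @` A).
Proof.
move=> [psi _ phiK] /finite_codimP[s As]; apply/finite_codimP.
exists (map phi s); apply/seteqP; split=> // v _.
by rewrite -[v]phiK; apply: adjoin_image; rewrite As.
Qed.

(** [A] has finite dimension modulo [A `&` B], because [G] has finite dimension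
    modulo [B]. *)
Lemma finite_codimI A B : subspace A -> subspace B ->
  finite_codim A -> finite_codim B -> finite_codim (A `&` B).
Proof.
move=> sA sB /finite_codimP[s As] /finite_codimP[t Bt].
have [|r _ Ar] := @adjoin_subspace A B t sA sB; first by rewrite Bt.
apply/finite_codimP; exists (s ++ r); rewrite adjoin_cat.
by apply/seteqP; split=> // v _; apply: (adjoinS Ar); rewrite As.
Qed.

Lemma subspace_image (phi : {linear G -> G}) A :
  subspace A -> subspace (phi @` A).
Proof.
move=> sA; apply/subspaceP; split.
  by exists 0; rewrite ?linear0 //; apply: subspace0.
move=> a _ _ [u Au <-] [v Av <-]; exists (a *: u + v); last exact: linearP.
exact: subspaceL.
Qed.

Lemma subspace_preimage (phi : {linear G -> G}) A :
  subspace A -> subspace (phi @^-1` A).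
Proof.
move=> sA; apply/subspaceP; split=> /=.
  by rewrite linear0; apply: subspace0.
by move=> a u v Au Av; rewrite linearP; apply: subspaceL.
Qed.

End Adjoin.

(** * Evaluation of multilinear elements *)

Section Multilinear.
Variables (K : fieldType) (G : lmodType K) (mul : {bilinear G -> G -> G}).
Variable n : nat.
Implicit Types (h : 'I_n -> G) (m : namonom 'I_n) (w : freeNA K n).

Lemma namonom_eval_notin k h1 h2 m :
  (forall i, i != k -> h1 i = h2 i) -> count_mem k (navars m) = 0%N ->
  namonom_eval mul h1 m = namonom_eval mul h2 m.
Proof.
move=> h12; elim: m => /= [i | m1 IH1 m2 IH2].
  by case: eqP => // /eqP/h12.
by rewrite count_cat => /eqP; rewrite addn_eq0 => /andP[/eqP/IH1-> /eqP/IH2->].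
Qed.

(** The variable [k] occurs in exactly one of the two factors of a product; the
    other factor takes the same value at [h], [h1] and [h2]. *)
Lemma namonom_eval_linear k a h h1 h2 m :
  h k = a *: h1 k + h2 k ->
  (forall i, i != k -> h i = h1 i) -> (forall i, i != k -> h i = h2 i) ->
  count_mem k (navars m) = 1%N ->
  namonom_eval mul h m = a *: namonom_eval mul h1 m + namonom_eval mul h2 m.
Proof.
move=> hk hh1 hh2; elim: m => /= [i | m1 IH1 m2 IH2].
  by case: eqP => // ->.
rewrite count_cat; case E1: (count_mem k (navars m1)) => [|[|c]] //.
  rewrite add0n => E2; rewrite IH2 // linearDr linearZr_LR /=.
  by rewrite -(namonom_eval_notin hh1 E1) -(namonom_eval_notin hh2 E1).
rewrite add1n => -[E2]; rewrite IH1 // linearDl linearZl_LR /=.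
by rewrite -(namonom_eval_notin hh1 E2) -(namonom_eval_notin hh2 E2).
Qed.

Lemma freeNA_eval_multilinear w k a h h1 h2 : multilinear w ->
  h k = a *: h1 k + h2 k ->
  (forall i, i != k -> h i = h1 i) -> (forall i, i != k -> h i = h2 i) ->
  freeNA_eval mul h w = a *: freeNA_eval mul h1 w + freeNA_eval mul h2 w.
Proof.
move=> mw hk hh1 hh2; rewrite /freeNA_eval scaler_sumr -big_split /=.
apply: eq_big_seq => m /mw/(_ k) mk.
by rewrite (namonom_eval_linear hk hh1 hh2 mk) scalerDr !scalerA mulrC.
Qed.

Lemma freeNA_eval_morph w (phi : {linear G -> G}) h :
  automorphism mul phi ->
  freeNA_eval mul (phi \o h) w = phi (freeNA_eval mul h w).
Proof.
case=> _ phiM; rewrite /freeNA_eval linear_sum; apply: eq_bigr => m _.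
rewrite linearZ; congr (_ *: _).
by elim: m => //= m1 -> m2 ->; rewrite phiM.
Qed.

End Multilinear.

(** * Invariant subspaces *)

Section Orbit.
Variables (K : fieldType) (G : lmodType K) (mul : {bilinear G -> G -> G}).
Implicit Types (A : set G) (phi psi : {linear G -> G}).

Lemma automorphism_inv phi : automorphism mul phi ->
  exists psi, [/\ automorphism mul psi, cancel phi psi & cancel psi phi].
Proof.
case=> [[g phiK gK] phiM].
have gL : linear g.
  by move=> a u v; apply: (can_inj phiK); rewrite linearP !gK.
pose gl := GRing.isLinear.Build K G G _ g gL.
pose psi : {linear G -> G} := HB.pack g gl.
exists psi; split=> //; split; first by exists phi.
by move=> u v; apply: (can_inj phiK); rewrite phiM !gK.
Qed.

Lemma automorphism_comp phi psi : automorphism mul phi ->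
  automorphism mul psi -> automorphism mul (phi \o psi : {linear G -> G}).
Proof.
move=> [bphi phiM] [bpsi psiM]; split; first exact: bij_comp.
by move=> u v /=; rewrite psiM phiM.
Qed.

Definition invariant A := forall phi, automorphism mul phi -> phi @` A `<=` A.

(** The inverse automorphism gives the reverse inclusion. *)
Lemma invariant_eq A phi : invariant A -> automorphism mul phi -> phi @` A = A.
Proof.
move=> iA aphi; apply/seteqP; split; first exact: iA.
move=> v Av; have [psi [apsi _ psiK]] := automorphism_inv aphi.
by exists (psi v); rewrite ?psiK //; apply: (iA _ apsi); exists v.
Qed.

(** The sum of the images of [A] under all automorphisms, as the smallest
    subspace containing them: to show that it lies in a given subspace it then
    suffices to look at one image at a time. *)
Definition orbit_sum A : set G :=
  smallest (@subspace K G)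
    [set v | exists2 phi, automorphism mul phi & (phi @` A) v].

Lemma sub_orbit_sum A phi : automorphism mul phi -> phi @` A `<=` orbit_sum A.
Proof. by move=> aphi v Av S [_]; apply; exists phi. Qed.

Lemma subset_orbit_sum A : A `<=` orbit_sum A.
Proof.
move=> v Av; apply: (@sub_orbit_sum _ (idfun : {linear G -> G})).
  by split=> //; exists idfun.
by exists v.
Qed.

Lemma orbit_sum_ind A S : subspace S ->
  (forall phi, automorphism mul phi -> phi @` A `<=` S) -> orbit_sum A `<=` S.
Proof. by move=> sS AS v; apply; split=> // u [phi aphi]; apply: AS. Qed.

Lemma subspace_orbit_sum A : subspace (orbit_sum A).
Proof.
apply/subspaceP; split=> [S [sS _] | a u v Au Av S SA].
  exact: subspace0.
by apply: subspaceL (Au _ SA) (Av _ SA); case: SA.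
Qed.

Lemma invariant_orbit_sum A : invariant (orbit_sum A).
Proof.
move=> phi aphi _ [v Av <-]; move: v Av.
apply: (@orbit_sum_ind _ (phi @^-1` orbit_sum A)).
  exact/subspace_preimage/subspace_orbit_sum.
move=> psi apsi _ [v Av <-] /=.
by apply: (sub_orbit_sum (automorphism_comp aphi apsi)); exists v.
Qed.

End Orbit.

(** * Replacing the arguments one at a time *)

Section Replacement.
Variables (K : fieldType) (G : lmodType K) (mul : {bilinear G -> G -> G}).
Variables (n : nat) (w : freeNA K n).
Implicit Types (L M X Y : set G) (k : 'I_n) (h : 'I_n -> G).

Definition mixed_values L k X M : set G :=
  [set freeNA_eval mul h w | h in [set h : 'I_n -> G |
    [/\ forall i : 'I_n, (i < k)%N -> L (h i), X (h k) &
        forall i : 'I_n, (k < i)%N -> M (h i)]]].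

(** [X] may be put in position [k], after arguments from [L], at the price of
    shrinking the subspace from which the later arguments come. *)
Definition tame L k X :=
  exists M, [/\ subspace M, finite_codim M &
                in_finite_dim (mixed_values L k X M)].

Lemma tameS L k X Y : Y `<=` X -> tame L k X -> tame L k Y.
Proof.
move=> YX [M [sM fM /in_finite_dimP[s Xs]]]; exists M; split=> //.
apply/in_finite_dimP; exists s => _ [h [hL hk hM] <-].
by apply: Xs; exists h => //; split=> //; apply: YX.
Qed.

(** Linearity in position [k] splits each value into one with an entry from
    [X] and one with an entry from [Y]; the later arguments are taken from the
    intersection of the two subspaces that make [X] and [Y] tame. With
    singletons this says that the tame vectors form a subspace. *)
Lemma tame_comb L k X Y : multilinear w -> tame L k X -> tame L k Y ->
  tame L k [set v | exists a u, X u /\ Y (v - a *: u)].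
Proof.
move=> mw [M [sM fM /in_finite_dimP[s Xs]]] [P [sP fP /in_finite_dimP[t Yt]]].
exists (M `&` P); split; [exact: subspaceI|exact: finite_codimI|].
apply/in_finite_dimP; exists (s ++ t) => _ [h [hL [a [u [Xu Yv]]] hMP] <-].
pose upd x : 'I_n -> G := fun i => if i == k then x else h i.
have updk x : upd x k = x by rewrite /upd eqxx.
have updE x i : i != k -> upd x i = h i by rewrite /upd => /negPf->.
rewrite (@freeNA_eval_multilinear _ _ _ _ _ k a _ (upd u) (upd (h k - a *: u))) //.
- have s0 := @subspace_zero K G.
  apply: subspaceL; first exact: subspace_adjoin.
    rewrite adjoin_cat; apply: (adjoinS (@sub_adjoin _ _ _ t)).
    apply: Xs; exists (upd u) => //; split; rewrite ?updk // => i ik.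
      by rewrite updE -?val_eqE /= ?(ltn_eqF ik) //; apply: hL.
    by rewrite updE -?val_eqE /= ?(gtn_eqF ik) //; case: (hMP i ik).
  rewrite adjoin_cat; apply: sub_adjoin.
  apply: Yt; exists (upd (h k - a *: u)) => //; split; rewrite ?updk // => i ik.
    by rewrite updE -?val_eqE /= ?(ltn_eqF ik) //; apply: hL.
  by rewrite updE -?val_eqE /= ?(gtn_eqF ik) //; case: (hMP i ik).
- by rewrite !updk addrC subrK.
- by move=> i /updE->.
- by move=> i /updE->.
Qed.

(** Transport along [phi]: the later arguments are taken from [phi @` M], and
    [L] is its own image. *)
Lemma tame_image L k M phi : invariant mul L -> subspace M -> finite_codim M ->
  in_finite_dim (mixed_values L k M M) -> automorphism mul phi ->
  tame L k (phi @` M).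
Proof.
move=> iL sM fM /in_finite_dimP[s Ms] aphi.
exists (phi @` M); split; first exact: subspace_image.
  by apply: finite_codim_image => //; case: aphi.
have [psi [apsi phiK psiK]] := automorphism_inv aphi.
have Mpsi v : (phi @` M) v -> M (psi v) by case=> u Mu <-; rewrite phiK.
apply/in_finite_dimP; exists (map phi s) => _ [h [hL hk hM] <-].
have -> : h = phi \o (psi \o h) by apply: funext => i /=; rewrite psiK.
rewrite freeNA_eval_morph //.
have : adjoin [set 0] s (freeNA_eval mul (psi \o h) w).
  apply: Ms; exists (psi \o h) => //; split=> [i ik | | i ik] /=.
  - by apply: (iL _ apsi); exists (h i) => //; apply: hL.
  - exact: Mpsi.
  - exact/Mpsi/hM.
move/(adjoin_image phi); apply: adjoinS => _ [v -> <-] /=.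
exact: linear0.
Qed.

(** Each vector of the orbit sum is tame, but the subspace of later arguments
    depends on the vector. A single subspace serves for the whole sum because
    finitely many vectors generate the sum modulo [M]. *)
Lemma tame_orbit_sum L k M : multilinear w ->
  invariant mul L -> subspace M -> finite_codim M ->
  in_finite_dim (mixed_values L k M M) -> tame L k (orbit_sum mul M).
Proof.
move=> mw iL sM fM Mfd.
have tamepts : orbit_sum mul M `<=` [set c | tame L k [set c]].
  apply: orbit_sum_ind => [|phi aphi v Mv /=]; last first.
    apply: tameS (tame_image iL sM fM Mfd aphi).
    by move=> _ ->.
  have tame0 : tame L k [set 0].
    apply: (@tameS _ _ M); last by exists M.
    by move=> _ ->; apply: subspace0.
  apply/subspaceP; split=> // a u v /= tu tv.
  apply: tameS (tame_comb mw tu tv) => _ ->.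
  by exists a, u; split=> //=; rewrite addrC addKr.
have /finite_codimP[s Ms] := fM.
have [|t tO Ot] := @adjoin_subspace K G (orbit_sum mul M) M s
  (subspace_orbit_sum _ _) sM; first by rewrite Ms.
apply: tameS Ot _; elim: t tO => [|c t IHt] tO /=.
  by apply: (@tameS _ _ M); [move=> v [] | exists M].
have tc : tame L k [set c] by apply: tamepts; apply: tO; rewrite mem_head.
have tOt : tame L k (adjoin (orbit_sum mul M `&` M) t).
  by apply: IHt => d dt; apply: tO; rewrite inE dt orbT.
by apply: tameS (tame_comb mw tc tOt) => v [a Mv]; exists a, c.
Qed.

(** Only [L] is invariant: intersecting with images under particular
    automorphisms, as each step does with [M], destroys invariance, whereas the
    orbit sums that [L] collects have it. *)
Lemma replace_arguments N (k : nat) : multilinear w ->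
  subspace N -> finite_codim N -> in_finite_dim (values mul w N) ->
  (k <= n)%N ->
  exists L M, [/\ [/\ subspace L, finite_codim L & invariant mul L],
    subspace M, finite_codim M &
    in_finite_dim [set freeNA_eval mul h w | h in [set h : 'I_n -> G |
      (forall i : 'I_n, (i < k)%N -> L (h i)) /\
      (forall i : 'I_n, (k <= i)%N -> M (h i))]]].
Proof.
move=> mw sN fN Nfd; elim: k => [_ | k IHk lt_kn].
  exists [set: G], N; split=> //.
    by split; [apply: subspace_setT | apply: finite_codim_setT | move].
  case/in_finite_dimP: Nfd => s Ns; apply/in_finite_dimP; exists s.
  by move=> _ [h [_ hN] <-]; apply: Ns; exists h => // i; apply: hN.
have [L [M [[sL fL iL] sM fM /in_finite_dimP[s Ms]]]] := IHk (ltnW lt_kn).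
have [|P [sP fP /in_finite_dimP[t Pt]]] :=
  @tame_orbit_sum L (Ordinal lt_kn) M mw iL sM fM.
  apply/in_finite_dimP; exists s => _ [h [hL hk hM] <-].
  apply: Ms; exists h => //; split=> // i.
  rewrite leq_eqVlt => /predU1P[ki | /hM//].
  by have -> : i = Ordinal lt_kn by apply: val_inj.
exists (L `&` orbit_sum mul M), P; split=> //.
  split.
  - exact: subspaceI (subspace_orbit_sum _ _).
  - apply: finite_codimI => //; first exact: subspace_orbit_sum.
    exact: finite_codim_sub (@subset_orbit_sum _ _ mul M) fM.
  - move=> phi aphi _ [v [Lv Ov] <-]; split; first by apply: (iL _ aphi); exists v.
    by apply: (invariant_orbit_sum aphi); exists v.
apply/in_finite_dimP; exists t => _ [h [hL hP] <-]; apply: Pt; exists h => //.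
split=> [i ik | | i ik].
- by have [] := hL i (ltnW ik).
- by have [] := hL (Ordinal lt_kn) (ltnSn k).
- exact: hP.
Qed.

End Replacement.
Theorem corollary2 (K : fieldType) (G : lmodType K)
    (mul : {bilinear G -> G -> G}) (N : set G)
    (n : nat) (w : freeNA K n) :
  subspace N -> finite_codim N -> multilinear w ->
  in_finite_dim (values mul w N) ->
  exists H : set G,
    [/\ subspace H, finite_codim H,
        forall phi : {linear G -> G}, automorphism mul phi -> phi @` H = H &
        in_finite_dim (values mul w H)].
Proof.
move=> sN fN mw Nfd.
have [L [M [[sL fL iL] _ _]]] := replace_arguments mw sN fN Nfd (leqnn n).
case/in_finite_dimP=> s Ls; exists L; split=> //.
  by move=> phi; apply: invariant_eq.
apply/in_finite_dimP; exists s => _ [h hL <-]; apply: Ls; exists h => //.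
by split=> i; [move=> _; apply: hL | rewrite leqNgt ltn_ord].
Qed.
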